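(* For every positive integer $n$, there exist $n$ distinct cycles (periodic orbits) of the standard tent map $T$ with the same center of mass.
   Context: The standard tent map is $T:[0,1]\to[0,1]$, $T(x)=1-|2x-1|$, i.e. $T(x)=2x$ for $x\in[0,\frac12]$ and $T(x)=2(1-x)$ for $x\in[\frac12,1]$. A point $x$ is $k$-periodic ($k\ge 1$) if $T^k(x)=x$; a cycle is the orbit $\{x,T(x),\dots,T^{k-1}(x)\}$ of a $k$-periodic point $x$. The center of mass of the cycle of a $k$-periodic point $x$ is $\bar{x}=\frac{1}{k}\left(x+T(x)+\cdots+T^{k-1}(x)\right)$ (this does not depend on the choice of $k$ with $T^k(x)=x$, nor on the choice of the point $x$ in the cycle). Distinct cycles are cycles that are distinct as sets; they may or may not have the same length. *)

(* Defs.v *)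
From mathcomp Require Import all_boot all_order all_algebra.
From mathcomp Require Import boolp classical_sets reals.
Set Implicit Arguments.
Unset Strict Implicit.
Unset Printing Implicit Defensive.
Import Order.TTheory GRing.Theory Num.Theory.
Local Open Scope ring_scope.
Local Open Scope classical_set_scope.

(* The tent map is a self-map of [0, 1] (lemma tent_itv01). It is given here by
   its formula on all of R; periodic points are required to lie in [0, 1]. *)
Definition tent (R : realType) (x : R) : R := 1 - `|2 * x - 1|.

Lemma tent_itv01 (R : realType) (x : R) : 0 <= x <= 1 -> 0 <= tent x <= 1.
Proof.
move=> /andP[x0 x1]; rewrite /tent subr_ge0 gerBl normr_ge0 andbT ler_norml.
by rewrite lerBrDr addNr mulr_ge0//= lerBlDr ler_piMr.
Qed.

Definition periodic_point (R : realType) (k : nat) (x : R) : Prop :=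
  [/\ (0 < k)%N, 0 <= x <= 1 & iter k (@tent R) x = x].

(* `I_k is the set of natural numbers i < k. *)
Definition cycle_of (R : realType) (k : nat) (x : R) : set R :=
  [set iter i (@tent R) x | i in `I_k].

Definition center_of_mass (R : realType) (k : nat) (x : R) : R :=
  k%:R^-1 * \sum_(i < k) iter i (@tent R) x.

(* Main.v *)
Require Import Defs.
From mathcomp Require Import all_boot all_order all_algebra.
From mathcomp Require Import boolp classical_sets reals.
From mathcomp Require Import zify ring lra.

Set Implicit Arguments.
Unset Strict Implicit.
Unset Printing Implicit Defensive.

Import Order.TTheory GRing.Theory Num.Theory.

(** Write x = 2 ||theta||, where ||theta|| is the distance from theta to the
    nearest integer. Then T x = 2 ||2 theta||, so the tent map is angle doubling
    up to sign. If theta has the k-periodic binary expansion b_1 b_2 b_3 ...,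
    then ||theta|| is obtained by complementing the expansion when b_1 = 1, and
    the orbit of x consists of the points
      x_i = 2 ||2^(i-1) theta||
          = (sum_(1 <= j <= k) 2^-j [b_i <> b_(i+j)]) / (1 - 2^-k).
    Summing over a period, the center of mass only depends on the numbers of
    mismatches #{i mod k | b_i <> b_(i+j)}, that is, on the cyclic
    autocorrelation of the word b (center_of_mass_word_point). Conversely the
    cycle determines b up to rotation and complement, because
    b_i <> b_(i+1) exactly when x_i > 1/2 (cycle_of_word_point_inj).

    So it is enough to have many periodic words with the same autocorrelation,
    no two of which agree up to rotation and complement. They come from the
    classical construction of homometric sets: the autocorrelation of a sumset
    A_0 + 8 A_1 + 64 A_2 + ... does not change when some of the A_l are
    reflected. Each A_l is taken to be {0,1,3} or its reflection {0,2,3},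
    according to a bit c_l; the resulting word, of period 8^m for m bits, has
    an autocorrelation that only depends on m (eq_autocorr), while the word up
    to rotation and complement determines all the bits (shift_rigid). *)

(** * Homometric periodic words *)

Definition block (e : bool) (r : nat) : bool :=
  r \in (if e then [:: 0; 1; 3] else [:: 0; 2; 3]).

(** Indicator of the integers i whose l-th octal digit, for each l < size c,
    lies in the set selected by the l-th bit of c; the least significant digit
    goes with the head of c. *)
Fixpoint word (c : seq bool) (i : nat) : bool :=
  if c is e :: c' then block e (i %% 8) && word c' (i %/ 8) else true.

Lemma word0 c : word c 0.
Proof. by elim: c => //= e c IH; rewrite IH; case: e. Qed.

Lemma word_cons e c q m :
  word (e :: c) (q * 8 + m) = block e (m %% 8) && word c (q + m %/ 8).
Proof. by rewrite /= modnMDl divnMDl. Qed.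

Lemma word_periodic c i : word c (i + 8 ^ size c) = word c i.
Proof.
elim: c i => //= e c IH i.
by rewrite expnSr addnC modnMDl divnMDl // addnC IH.
Qed.

Lemma sum_base8 (F : nat -> nat) k :
  \sum_(i < k * 8) F i = \sum_(r < 8) \sum_(q < k) F (q * 8 + r).
Proof.
rewrite exchange_big /= -(big_mkord xpredT F) big_nat_mul big_mkord.
apply: eq_bigr => q _; rewrite mulSn addnC -{1}[q * 8]add0n big_addn addKn.
by rewrite big_mkord; apply: eq_bigr => r _; rewrite addnC.
Qed.

Definition autocorr (c : seq bool) (j : nat) : nat :=
  \sum_(i < 8 ^ size c) (word c i && word c (i + j)).

(** Adding j to 8 q + r adds (r + j) %/ 8 to q, so that the correlations at the
    lowest digit and at the higher digits separate. *)
Lemma autocorr_cons e c j :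
  autocorr (e :: c) j =
  \sum_(r < 8) (block e r && block e ((r + j) %% 8)) *
               autocorr c ((r + j) %/ 8).
Proof.
rewrite /autocorr [size _]/= expnSr.
rewrite (sum_base8 (fun i => word (e :: c) i && word (e :: c) (i + j))).
apply: eq_bigr => r _; rewrite big_distrr /=; apply: eq_bigr => q _.
rewrite -addnA !modnMDl !divnMDl // (modn_small (ltn_ord r)).
by rewrite (divn_small (ltn_ord r)) addn0 -mulnb -!mulnb; ring.
Qed.

(** In autocorr_cons the lowest bit only enters through the number of pairs in
    its block at each distance, with and without carry. These numbers are
    invariant under the reflection r |-> 3 - r exchanging the two blocks. *)
Lemma eq_autocorr c c' : size c = size c' -> autocorr c =1 autocorr c'.
Proof.
elim: c c' => [|e c IH] [|e' c'] //= [/IH eqc] j.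
rewrite !autocorr_cons [in RHS](eq_bigr _ (fun r _ => congr1 _ (esym (eqc _)))).
rewrite (divn_eq j 8); have: j %% 8 < 8 by rewrite ltn_mod.
move: (j %/ 8) (j %% 8) (autocorr c) => t s f s_lt8.
have carry b : \sum_(r < 8) (block b r && block b ((r + (t * 8 + s)) %% 8)) *
      f ((r + (t * 8 + s)) %/ 8) =
    \sum_(r < 8) (block b r && block b ((r + s) %% 8)) * f ((r + s) %/ 8 + t).
  apply: eq_bigr => r _.
  by rewrite addnCA modnMDl divnMDl // [t + _]addnC.
rewrite !{}carry !big_ord_recl !big_ord0.
(* For each residue s of j modulo 8, both sides become the same explicit
   combination of f t and f t.+1. *)
by case: e; case: e' => //; do 8?[case: s s_lt8 => [_|s s_lt8]].
Qed.

Lemma shifted_weight c j : \sum_(i < 8 ^ size c) word c (i + j) = 3 ^ size c.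
Proof.
elim: c j => [|e c IH] j; first by rewrite big_ord1.
rewrite expnSr (sum_base8 (fun i => nat_of_bool (word (e :: c) (i + j)))).
transitivity (\sum_(r < 8) block e ((r + j) %% 8) * 3 ^ size c).
  apply: eq_bigr => r _; rewrite -(IH ((r + j) %/ 8)) big_distrr /=.
  by apply: eq_bigr => q _; rewrite -addnA modnMDl divnMDl // mulnb.
rewrite -big_distrl expnS /=; congr (_ * _).
have: j %% 8 < 8 by rewrite ltn_mod.
under eq_bigr do rewrite -modnDmr.
move: (j %% 8) => s s_lt8; rewrite !big_ord_recl big_ord0.
by case: e; do 8?[case: s s_lt8 => [_|s s_lt8]].
Qed.

Definition mismatches (b : nat -> bool) (k j : nat) : nat :=
  \sum_(i < k) (b i (+) b (i + j)).

(** For bits, (u (+) v) + 2 (u && v) = u + v; hence the mismatches are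
    determined by the autocorrelation and the number of ones. *)
Lemma eq_mismatches c c' : size c = size c' ->
  mismatches (word c) (8 ^ size c) =1 mismatches (word c') (8 ^ size c').
Proof.
move=> eqs j.
have count d :
    mismatches (word d) (8 ^ size d) j + 2 * autocorr d j = 2 * 3 ^ size d.
  rewrite [in RHS]mul2n -addnn -{1}(shifted_weight d 0) -(shifted_weight d j).
  rewrite /mismatches /autocorr big_distrr /= -!big_split /=.
  by apply: eq_bigr => i _; rewrite addn0; case: word; case: word.
have := count c; have := count c'; rewrite eqs (eq_autocorr eqs); lia.
Qed.

(** A window of word c at an octal block holding {0,1,3} or {0,2,3} followed by
    four zeros can only match word c' at a block boundary. A window straddling
    two blocks of word c' after at most 4 letters of the first would have the
    start of the second, a one unless that block is empty, among its four last
    letters, hence too few ones; after 5 letters or more it would begin with a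
    zero. Nor can it match the complement of word c', which would need four
    consecutive ones in word c'. So the shift is a multiple of 8, the lowest bits agree, and the
    same argument applies to the words of higher digits. *)
Lemma shift_rigid k s c c' :
  size c = size c' -> (forall i, word c i = k (+) word c' (i + s)) -> c = c'.
Proof.
elim: c c' k s => [|e c IH] [|e' c'] // k s [eqs] shift.
have windows q r : (r < 8)%N -> word c q && block e r =
    k (+) (block e' ((r + s %% 8) %% 8) &&
           word c' ((r + s %% 8) %/ 8 + (q + s %/ 8))).
  move=> r_lt8; have := shift (q * 8 + r).
  rewrite word_cons modn_small // divn_small // addn0 andbC => ->.
  rewrite {1}(divn_eq s 8) addnACA -mulnDl word_cons.
  by rewrite [q + _ + _]addnC.
(* The first window suffices, since word c 0 holds. With a the residue of the
   shift, it only involves two consecutive blocks of word (e' :: c'), so that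
   finitely many cases remain. *)
have: [/\ e = e', k = false & s %% 8 = 0].
  have W r := windows 0 r; rewrite word0 in W.
  have := W 0 isT; have := W 1 isT; have := W 2 isT; have := W 3 isT.
  have := W 4 isT; have := W 5 isT; have := W 6 isT; have := W 7 isT.
  have: s %% 8 < 8 by rewrite ltn_mod.
  move: (s %% 8) (0 + s %/ 8) => a t; clear shift windows W IH eqs.
  by do 8?[case: a => [_|a]] => //=; rewrite /divn /= ?add0n ?add1n;
    case: k; case: e; case: e'; case: (word c' t); case: (word c' t.+1).
case=> ee' k0 s0; rewrite -ee'; congr (_ :: _); apply: (IH c' k (s %/ 8)) => // q.
have block0 d : block d 0 by case: d.
by have := windows q 0 isT; rewrite s0 addn0 mod0n div0n !block0 andbT.
Qed.

Local Open Scope ring_scope.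

(** * Periodic points of the tent map coded by binary words *)

(** Twice the distance to the nearest integer of the number with binary
    expansion b i, b i.+1, b i.+2, ..., when b has period k. *)
Definition word_point (R : realType) (b : nat -> bool) (k i : nat) : R :=
  (\sum_(j < k) 2^-1 ^+ j.+1 * (b i (+) b (i + j.+1)%N)%:R) / (1 - 2^-1 ^+ k).

Section WordPoint.
Variables (R : realType) (b : nat -> bool) (k : nat).
Hypotheses (k_gt0 : (0 < k)%N) (b_periodic : forall i, b (i + k)%N = b i).

Let h : R := 2^-1.
Let y (i : nat) : R := \sum_(j < k) h ^+ j.+1 * (b i (+) b (i + j.+1)%N)%:R.

Lemma sum_half n : \sum_(j < n) h ^+ j.+1 = 1 - h ^+ n.
Proof.
elim: n => [|n IH]; first by rewrite big_ord0 expr0 subrr.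
by rewrite big_ord_recr /= IH !exprS /h; lra.
Qed.

Lemma half_lt1 : h ^+ k < 1.
Proof. by rewrite exprn_ilt1 -?lt0n// /h; lra. Qed.

(** Doubling drops the first digit; the others are then compared with b i.+1
    instead of b i, which complements all of them when b i <> b i.+1. The period makes the last of the k comparisons trivial. *)
Lemma num_step i : 2 * y i =
   if b i == b i.+1 then y i.+1 else 2 * (1 - h ^+ k) - y i.+1.
Proof.
rewrite /y; case: k k_gt0 b_periodic => // k' _ per.
rewrite big_ord_recl big_ord_recr /= addn1 per addbb mulr0 addr0.
set z := \sum_(j < k') _; set z' := \sum_(j < k') _.
have -> : z = h * (if b i == b i.+1 then z' else (1 - h ^+ k') - z').
  rewrite -sum_half /z /z' -sumrB; case: eqP => [->|bi]; rewrite big_distrr /=;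
    apply: eq_bigr => j _; rewrite /bump leq0n add1n addSnnS [h ^+ j.+2]exprS.
    by rewrite mulrA.
  rewrite -mulrA; congr (_ * _); move: bi.
  by case: (b i); case: (b i.+1); case: (b _) => //= _; ring.
rewrite [h ^+ k'.+1]exprS expr1; case: eqP => [->|].
  by rewrite addbb /= /h; lra.
by case: (b i); case: (b i.+1) => //= _; rewrite /h; lra.
Qed.

Lemma word_point_ge0 i : 0 <= word_point R b k i.
Proof.
rewrite divr_ge0 ?subr_ge0 ?(ltW half_lt1)//.
by apply: sumr_ge0 => j _; rewrite mulr_ge0 ?exprn_ge0 ?ler0n ?invr_ge0.
Qed.

(** Strict because the last of the k digits vanishes; this strictness keeps the
    orbit off the turning point 1/2, where the itinerary would be ambiguous. *)
Lemma word_point_lt1 i : word_point R b k i < 1.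
Proof.
rewrite ltr_pdivrMr ?subr_gt0 ?half_lt1// mul1r.
case: k k_gt0 b_periodic => // k' _ per.
rewrite big_ord_recr /= per addbb mulr0 addr0.
apply: (@le_lt_trans _ _ (1 - h ^+ k')).
  rewrite -sum_half; apply: ler_sum => j _.
  by rewrite ler_piMr ?exprn_ge0 ?invr_ge0// lern1 leq_b1.
by rewrite ltrD2l ltrN2 exprS gtr_pMl ?exprn_gt0 ?invr_gt0// /h; lra.
Qed.

Lemma word_point_step i : 2 * word_point R b k i =
  if b i == b i.+1 then word_point R b k i.+1
  else 2 - word_point R b k i.+1.
Proof.
have d_neq0 : 1 - h ^+ k != 0 by rewrite subr_eq0 gt_eqF ?half_lt1.
rewrite /word_point mulrA num_step; case: eqP => // _.
by rewrite mulrBl mulfK.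
Qed.

Lemma tent_word_point i : tent (word_point R b k i) = word_point R b k i.+1.
Proof.
rewrite /tent word_point_step; have := word_point_lt1 i.+1.
case: eqP => _ x_lt1.
  by rewrite ltr0_norm; lra.
by rewrite gtr0_norm; lra.
Qed.

Lemma word_point_itinerary i :
  (b i (+) b i.+1) = (2^-1 < word_point R b k i).
Proof.
have := word_point_lt1 i.+1; have := word_point_step i.
case: eqP => [->|/eqP]; first by rewrite addbb => ? ?; apply/esym/negP; lra.
by case: (b i); case: (b i.+1) => //= _ ? ?; apply/esym; lra.
Qed.

Lemma iter_tent_word_point n i :
  iter n (@tent R) (word_point R b k i) = word_point R b k (i + n).
Proof.
elim: n => [|n IH]; first by rewrite addn0.
by rewrite iterS IH tent_word_point addnS.
Qed.

Lemma periodic_word_point i : periodic_point k (word_point R b k i).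
Proof.
split=> //; first by rewrite word_point_ge0 ltW ?word_point_lt1.
rewrite iter_tent_word_point /word_point; congr (_ / _); apply: eq_bigr => j _.
by rewrite b_periodic addnAC b_periodic.
Qed.

Lemma center_of_mass_word_point :
  center_of_mass k (word_point R b k 0) =
  k%:R^-1 * ((\sum_(j < k) 2^-1 ^+ j.+1 * (mismatches b k j.+1)%:R)
             / (1 - 2^-1 ^+ k)).
Proof.
congr (_ * _); under eq_bigr do rewrite iter_tent_word_point add0n.
rewrite -mulr_suml exchange_big; congr (_ / _); apply: eq_bigr => j _.
by rewrite natr_sum big_distrr.
Qed.

End WordPoint.

(** A common point of the two cycles has a common forward itinerary, which
    gives the differences of consecutive letters of b and of a rotation of b';
    hence the words themselves up to the choice of one letter. *)
Lemma cycle_of_word_point_inj (R : realType) (b b' : nat -> bool) (k : nat) :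
  (0 < k)%N -> (forall i, b (i + k)%N = b i) ->
  (forall i, b' (i + k)%N = b' i) ->
  cycle_of k (word_point R b k 0) = cycle_of k (word_point R b' k 0) ->
  exists e s, forall i, b i = e (+) b' (i + s)%N.
Proof.
move=> k_gt0 per per' eqC.
have : cycle_of k (word_point R b k 0) (word_point R b k 0) by exists 0%N.
rewrite eqC => -[s _]; rewrite iter_tent_word_point // add0n => xs.
exists (b 0%N (+) b' s), s; elim=> [|i IH]; first by rewrite add0n addbK.
have : (b i (+) b i.+1) = (b' (i + s)%N (+) b' (i + s).+1).
  rewrite !(word_point_itinerary R k_gt0) //.
  by rewrite -[i]add0n -iter_tent_word_point // -xs iter_tent_word_point // addnC.
rewrite IH addSn.
by case: (b 0%N); case: (b' s); case: (b' _); case: (b i.+1); case: (b' _).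
Qed.

Theorem theorem1 (R : realType) (n : nat) (hn : (0 < n)%N) :
  exists (k : 'I_n -> nat) (x : 'I_n -> R),
    [/\ forall i : 'I_n, periodic_point (k i) (x i),
        forall i j : 'I_n, i <> j ->
          cycle_of (k i) (x i) <> cycle_of (k j) (x j)
      & forall i j : 'I_n,
          center_of_mass (k i) (x i) = center_of_mass (k j) (x j)].
Proof.
(* Any n distinct bit lists of equal size would do; the i-th one here has a
   single bit set, at position i. *)
pose c (i : 'I_n) := mkseq (pred1 (nat_of_ord i)) n.
have size_c i : size (c i) = n by rewrite size_mkseq.
have per i m : word (c i) (m + 8 ^ n)%N = word (c i) m.
  by rewrite -(size_c i) word_periodic.
have k_gt0 : (0 < 8 ^ n)%N by rewrite expn_gt0.
exists (fun=> 8 ^ n)%N, (fun i => word_point R (word (c i)) (8 ^ n) 0).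
split=> [i|i j ij eqC|i j]; first exact: periodic_word_point.
  have [e [s shift]] := cycle_of_word_point_inj k_gt0 (per i) (per j) eqC.
  have /(congr1 (nth false ^~ i)) : c i = c j.
    by apply: shift_rigid shift; rewrite !size_c.
  rewrite !nth_mkseq //= eqxx => /esym/eqP/val_inj.
  exact: ij.
rewrite !center_of_mass_word_point //; congr (_ * (_ / _)).
apply: eq_bigr => m _; have := @eq_mismatches (c i) (c j).
by rewrite !size_c => ->.
Qed.
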